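(* Let $(e_n)_{n=1}^\infty$ be a subsymmetric Schauder basis for a real Banach space $X$, let $E$ be a separable complete metric space, and let $R$ be either $\mathbb Z$ or $\mathbb Q$. Then either $R[e_1,e_2,e_3,\ldots]$ (with the metric induced by the norm of $X$) coarsely embeds into $E$, or the rank $\mathsf{rk}\big(\mathcal{C}oa(R,(e_n),E),<\big)$ is countable.
   Context: Subsymmetric is used in the standard sense (an unconditional basis equivalent to each of its infinite subsequences). $R[e_1,e_2,\ldots]\subseteq X$ is the set of finite linear combinations of the $e_n$ with coefficients in $R$; for $A\subseteq\{e_1,e_2,\ldots\}$, $R[A]$ is the $R$-submodule spanned by $A$. Let $\mathcal Z=\{\ldots,\tfrac13,\tfrac12,1,2,3,\ldots\}$ and $\mathcal N=\{\kappa\colon\mathcal Z\to[0,\infty]\mid\kappa\text{ is non-decreasing}\}$. For real $t>0$, let $t_-$ and $t_+$ be respectively the largest and smallest elements of $\mathcal Z$ with $t_-\leqslant t\leqslant t_+$. For a map $\phi\colon Y\to E$ between non-empty metric spaces and $r\in\mathcal Z$ put $\kappa_\phi(r)=\inf\{d_E(\phi(x),\phi(y)): d_Y(x,y)\geqslant r\}$ (with $\inf\emptyset=\infty$) and $\omega_\phi(r)=\sup\{d_E(\phi(x),\phi(y)): d_Y(x,y)\leqslant r\}$. Let $$\mathcal M_{\mathrm{coarse}}=\{(\kappa,\omega)\in\mathcal N\times\mathcal N:\ \omega(r)<\infty\text{ for all }r\in\mathcal Z\text{ and }\lim_{n\to\infty}\kappa(n)=\infty\}.$$ The map $\phi$ is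 a coarse embedding if $(\kappa_\phi,\omega_\phi)\in\mathcal M_{\mathrm{coarse}}$. For finite $A,B\subseteq\{e_1,e_2,\ldots\}$, write $A\prec^\star B$ if $B=\{e_{n_1},\ldots,e_{n_k}\}$ and $A=\{e_{n_1},\ldots,e_{n_k},e_{n_{k+1}}\}$ for some $n_1<\cdots<n_k<n_{k+1}$. $\mathcal{C}oa(R,(e_n),E)$ is the set of all quadruples $(\kappa,\omega,A,\phi)$ where $(\kappa,\omega)\in\mathcal M_{\mathrm{coarse}}$, $A$ is a finite subset of $\{e_1,e_2,\ldots\}$, and $\phi\colon R[e_1,e_2,\ldots]\to E$ is a function such that $$\kappa\big(\|x-y\|_-\big)\leqslant d_E\big(\phi(x),\phi(y)\big)\leqslant\omega\big(\|x-y\|_+\big)$$ for all distinct $x,y\in R[A]$. The relation $<$ on it is defined by: $(\kappa,\omega,A,\phi)<(\kappa',\omega',A',\phi')$ if and only if $(\kappa,\omega)=(\kappa',\omega')$, $A\prec^\star A'$, and $\phi$ and $\phi'$ agree on $R[A']$. A binary relation $\prec$ on a set $S$ is well-founded if there is no infinite sequence $\cdots\prec a_3\prec a_2\prec a_1$ in $S$. For well-founded $\prec$, define $\rho\colon S\to\mathrm{Ord}$ by $\rho(x)=\sup\{\rho(y)+1: y\prec x\}$ and $\mathsf{rk}(S,\prec)=\sup\{\rho(x)+1: x\in S\}$. The assertion that the rank is countable includes that the relation is well-founded (so that the rank is defined). *)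

(* Defs.v *)
From HB Require Import structures.
From mathcomp Require Import all_boot all_order all_algebra.
From mathcomp Require Import all_classical all_reals all_analysis.

Set Implicit Arguments.
Unset Strict Implicit.
Unset Printing Implicit Defensive.

Import Order.TTheory GRing.Theory Num.Theory.
Import numFieldNormedType.Exports.

Local Open Scope classical_set_scope.
Local Open Scope ring_scope.

Section SchauderBases.
Variables (R : realType) (X : normedModType R).
Implicit Types (e f : nat -> X) (a : nat -> R) (x : X).

Definition expansion a e : nat -> X := series (fun n => a n *: e n).

Definition schauder_basis e : Prop :=
  forall x, exists! a, expansion a e @ \oo --> x.

Definition unconditional_basis e : Prop :=
  schauder_basis e /\
  forall x a, expansion a e @ \oo --> x ->
    forall s : nat -> nat, bijective s ->
      expansion (a \o s) (e \o s) @ \oo --> x.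

Definition equivalent_seqs e f : Prop :=
  forall a, cvg (expansion a e @ \oo) <-> cvg (expansion a f @ \oo).

Definition subsymmetric e : Prop :=
  unconditional_basis e /\
  forall s : nat -> nat, {homo s : i j / (i < j)%N} ->
    equivalent_seqs e (e \o s).

(* For [C] the set of integers or of rationals in [R], this is the
   [C]-submodule spanned by [A]. *)
Definition rspan (C : set R) (A : set X) : set X :=
  [set x | exists n (c : 'I_n -> R) (a : 'I_n -> X),
      (forall i, C (c i) /\ A (a i)) /\ x = \sum_(i < n) c i *: a i].

(* [B = {e_{n_1}, ..., e_{n_k}}] and [A = {e_{n_1}, ..., e_{n_k}, e_m}] with
   [n_1 < ... < n_k < m]; [k = 0] is allowed. *)
Definition one_step_ext e (A B : set X) : Prop :=
  exists (s : seq nat) (m : nat), sorted ltn (rcons s m) /\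
    B = [set e i | i in [set` s]] /\ A = [set e i | i in [set` rcons s m]].

End SchauderBases.

Section MetricSpaces.
Variables (R : realType) (E : metricType R).

Definition complete_metric : Prop :=
  forall F : set_system E, ProperFilter F -> cauchy F -> exists l : E, F --> l.

Definition separable_metric : Prop :=
  exists D : set E, countable D /\ dense D.

End MetricSpaces.

Section Moduli.
Variable R : realType.

Definition Zset : set R :=
  [set r | exists n : nat, r = n.+1%:R \/ r = n.+1%:R^-1].

Lemma Zset_nat n : n.+1%:R \in Zset.
Proof. by rewrite inE; exists n; left. Qed.

Definition Znat (n : nat) : Zset := exist _ n.+1%:R (Zset_nat n).

Definition is_Zminus (t : R) (r : Zset) : Prop :=
  val r <= t /\ forall s : Zset, val s <= t -> val s <= val r.

Definition is_Zplus (t : R) (r : Zset) : Prop :=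
  t <= val r /\ forall s : Zset, t <= val s -> val r <= val s.

(* [Zminus t] and [Zplus t] take the arbitrary value [1] if [t <= 0]. *)
Definition Zminus (t : R) : Zset := xget (Znat 0) (is_Zminus t).
Definition Zplus (t : R) : Zset := xget (Znat 0) (is_Zplus t).

Lemma ZminusP (t : R) : 0 < t -> is_Zminus t (Zminus t).
Proof.
move=> t0; apply: xgetPex; have [t1|t1] := leP 1 t.
  have tr : (0 < Num.truncn t)%N by rewrite truncn_ge_nat// ltW.
  exists (Znat (Num.truncn t).-1); split => /=.
    by rewrite prednK// truncn_le// ltW.
  move=> [s /= sZ]; rewrite prednK//; move/set_mem: sZ => [n [->|->]] st.
    by rewrite ler_nat truncn_ge_nat// ltW.
  by rewrite (@le_trans _ _ 1) ?ler1n// invf_le1 ?ltr0n// ler1n.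
have ex : exists n : nat, t^-1 <= n.+1%:R.
  exists (Num.truncn t^-1); exact/ltW/truncnS_gt.
case: (ex_minnP ex) => n tn nmin.
have nZ : n.+1%:R^-1 \in Zset by rewrite inE; exists n; right.
exists (exist (fun x : R => x \in Zset) _ nZ); split => /=; first by rewrite invf_ple ?posrE ?ltr0n.
move=> [s /= sZ]; move/set_mem: sZ => [m [->|->]] st.
  by have := le_lt_trans st t1; rewrite ltrn1.
rewrite lef_pV2 ?posrE ?ltr0n// ler_nat ltnS nmin//.
by rewrite invf_ple ?posrE ?ltr0n.
Qed.

Lemma Zset_gt0 (r : Zset) : 0 < val r.
Proof. by case: r => r /= /set_mem[n [->|->]]; rewrite ?invr_gt0 ltr0n. Qed.

Lemma Zset_inv (r : Zset) : (val r)^-1 \in Zset.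
Proof.
case: r => r /= /set_mem[n [->|->]]; rewrite inE; exists n; rewrite ?invrK.
  by right.
by left.
Qed.

Lemma ZplusP (t : R) : 0 < t -> is_Zplus t (Zplus t).
Proof.
move=> t0; apply: xgetPex.
have ti : 0 < t^-1 by rewrite invr_gt0.
have [lo mx] := ZminusP ti; set r := Zminus t^-1 in lo mx.
exists (exist (fun x : R => x \in Zset) _ (Zset_inv r)); split => /=.
  by rewrite -(invrK t) lef_pV2 ?posrE ?Zset_gt0.
move=> s ts; have := mx (exist (fun x : R => x \in Zset) _ (Zset_inv s)) => /=.
rewrite lef_pV2 ?posrE ?Zset_gt0// => /(_ ts) sr.
by rewrite invf_ple ?posrE ?Zset_gt0.
Qed.

Definition modulus (k : Zset -> \bar R) : Prop :=
  (forall r, (0 <= k r)%E) /\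
  (forall r s : Zset, val r <= val s -> (k r <= k s)%E).

Definition M_coarse (k w : Zset -> \bar R) : Prop :=
  modulus k /\ modulus w /\
  (forall r, (w r < +oo)%E) /\ (fun n => k (Znat n)) @ \oo --> +oo%E.

Variables (Y : Type) (dY : Y -> Y -> R) (E : metricType R).

Definition compression (phi : Y -> E) (r : Zset) : \bar R :=
  ereal_inf [set (mdist (phi p.1) (phi p.2))%:E
            | p in [set p : Y * Y | val r <= dY p.1 p.2]].

Definition expansion_modulus (phi : Y -> E) (r : Zset) : \bar R :=
  ereal_sup [set (mdist (phi p.1) (phi p.2))%:E
            | p in [set p : Y * Y | dY p.1 p.2 <= val r]].

Definition coarse_embedding (phi : Y -> E) : Prop :=
  M_coarse (compression phi) (expansion_modulus phi).

End Moduli.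

Arguments Zset R : clear implicits.

Definition norm_dist (R : realType) (X : normedModType R) (A : set X)
  (x y : A) : R := `|val x - val y|.

Section Coa.
Variables (R : realType) (X : normedModType R) (C : set R) (e : nat -> X).
Variable E : metricType R.

Record coa := Coa {
  coa_k : Zset R -> \bar R;
  coa_w : Zset R -> \bar R;
  coa_set : set X;
  coa_map : rspan C (range e) -> E;
  coa_mod : M_coarse coa_k coa_w;
  coa_sub : coa_set `<=` range e;
  coa_fin : finite_set coa_set;
  coa_bounds : forall x y : rspan C (range e),
    rspan C coa_set (val x) -> rspan C coa_set (val y) -> x <> y ->
    (coa_k (Zminus (norm_dist x y)) <= (mdist (coa_map x) (coa_map y))%:E)%E /\
    ((mdist (coa_map x) (coa_map y))%:E <= coa_w (Zplus (norm_dist x y)))%E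
}.

Definition coa_lt (a b : coa) : Prop :=
  coa_k a = coa_k b /\ coa_w a = coa_w b /\
  one_step_ext e (coa_set a) (coa_set b) /\
  forall x : rspan C (range e),
    rspan C (coa_set b) (val x) -> coa_map a x = coa_map b x.

End Coa.

(* Ordinals as well-founded trees, [osup f] standing for the supremum of the
   [f i + 1]; two trees denote the same ordinal when [oeq] relates them. *)
Inductive Ord : Type := osup (T : Type) (f : T -> Ord).

(* sup (f i + 1) <= sup (g j + 1) iff each f i is below some g j. *)
Fixpoint ole (a b : Ord) {struct a} : Prop :=
  let: osup T f := a in let: osup U g := b in
  forall i : T, exists j : U, ole (f i) (g j).

Definition olt (a b : Ord) : Prop :=
  let: osup U g := b in exists j : U, ole a (g j).

Definition oeq (a b : Ord) : Prop := ole a b /\ ole b a.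

(* [a] has at most countably many predecessors. *)
Definition countable_ord (a : Ord) : Prop :=
  exists f : nat -> Ord, forall b, olt b a -> exists n, oeq b (f n).

Section Rank.
Variables (S : Type) (prec : S -> S -> Prop).

Definition wellfounded : Prop :=
  ~ exists a : nat -> S, forall n, prec (a n.+1) (a n).

Lemma wellfounded_Acc : wellfounded -> well_founded prec.
Proof.
move=> W x0; apply: contrapT => Nx0; apply: W.
pose T := {x : S | ~ Acc prec x}.
have step (x : T) : {y : T | prec (sval y) (sval x)}.
  apply: cid; case: x => x /= Nx; apply: contrapT => H; apply: Nx.
  constructor=> y yx; apply: contrapT => Ny; apply: H.
  by exists (exist _ y Ny).
exists (fun n => sval (iter n (fun x => sval (step x)) (exist _ x0 Nx0))) => n.
by rewrite iterS; move: (iter n _ _) => y; exact: (svalP (step y)).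
Qed.

Definition rho (W : wellfounded) : S -> Ord :=
  Fix (wellfounded_Acc W) (fun=> Ord)
    (fun x rec => osup (fun y : {y | prec y x} => rec (sval y) (svalP y))).

Lemma rhoE (W : wellfounded) (x : S) :
  rho W x = osup (fun y : {y | prec y x} => rho W (sval y)).
Proof.
rewrite /rho Fix_eq// => z f g fg; congr osup.
by apply/funext => y; exact: fg.
Qed.

Definition rk (W : wellfounded) : Ord := osup (rho W).

(* Well-foundedness is part of the claim: the rank is defined only then. *)
Definition countable_rank : Prop :=
  exists W : wellfounded, countable_ord (rk W).

End Rank.

(* Main.v *)
(** Instead of an infinite descending sequence of attempts, an "approximate" one
already yields a coarse embedding. An attempt (kappa, omega, A, phi) with #|A| = k is
truncated to a node: the first k values of integer witnesses of
omega < oo and kappa -> oo, the set A, and, for the first k elements of R[A],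
indices of points of a dense sequence of E within 2^-k of their images. There
are countably many nodes, and truncation is monotone for the relation of
compatible one-step refinement of nodes. If that relation is well-founded it
bounds the rank by a countable ordinal (the Kunen-Martin argument). Otherwise an
infinite branch converges, E being complete, to a coarse embedding of
R[e_{s 0}, e_{s 1}, ...] for some increasing s, and R[e_0, e_1, ...] is linearly
equivalent to it.

This last equivalence is quantitative: the partial sum projections of a Schauder
basis are uniformly bounded (Baire category and successive approximation), and if
convergence of the expansions along u implies convergence along v without a norm
estimate, a gliding hump produces an expansion convergent along u but not along
v. *)

From HB Require Import structures.
Require Import Defs.
From mathcomp Require Import all_boot all_order all_algebra.
From mathcomp Require Import all_classical all_reals all_analysis.
From mathcomp Require Import ring lra zify.
Import numFieldNormedType.Exports.
Local Open Scope classical_set_scope.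
Local Open Scope ring_scope.

Import Order.TTheory GRing.Theory Num.Theory.
Set Implicit Arguments.
Unset Strict Implicit.
Unset Printing Implicit Defensive.

(** * Basis constants and the gliding hump *)

Section SequenceLimits.
Variable R : realType.

Lemma cvgnP (X : normedModType R) (u : nat -> X) (l : X) :
  u @ \oo --> l <->
  forall eps, 0 < eps -> exists n, forall m, (n <= m)%N -> `|u m - l| <= eps.
Proof.
split=> [/cvgrPdist_le ul eps e0|H].
  have [n _ Hn] := ul _ e0; exists n => m nm.
  by rewrite distrC; exact: Hn.
apply/cvgrPdist_le => eps e0; have [n Hn] := H _ e0.
by exists n => // m /= nm; rewrite distrC; exact: Hn.
Qed.

Lemma cvgn_cauchy (X : completeNormedModType R) (u : nat -> X) :
  (forall eps, 0 < eps ->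
    exists n, forall m, (n <= m)%N -> `|u m - u n| <= eps) ->
  cvgn u.
Proof.
move=> H; apply: cauchy_cvg; apply: cauchy_exP => eps e0.
have e20 : 0 < eps / 2 by rewrite divr_gt0.
have [n Hn] := H _ e20; exists (u n); exists n => // m /= nm.
rewrite -ball_normE /ball_ /= distrC; apply: le_lt_trans (Hn _ nm) _.
lra.
Qed.

Lemma cvgn_dist_le (X : normedModType R) (u : nat -> X) (l v : X) n b :
  u @ \oo --> l -> (forall m, (n <= m)%N -> `|u m - v| <= b) -> `|l - v| <= b.
Proof.
move=> /cvgnP ul H; apply/ler_addgt0Pr => eps e0.
have [k Hk] := ul _ e0.
have := Hk (maxn n k) (leq_maxr _ _); have := H (maxn n k) (leq_maxl _ _).
move: (u _) => w H1 H2.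
by rewrite (le_trans (ler_distD w _ _))// (distrC l) addrC lerD.
Qed.

Lemma half_pow_small (c eps : R) : 0 < eps ->
  exists n, forall m, (n <= m)%N -> c * 2^-1 ^+ m <= eps.
Proof.
move=> e0.
have : (fun n => c * 2^-1 ^+ n) @ \oo --> (0 : R).
  rewrite -[X in _ --> X](mulr0 c); apply: cvgM; [exact: cvg_cst|apply: cvg_expr].
  by rewrite gtr0_norm ?invr_gt0// invf_lt1// ltr1n.
move=> /cvgnP /(_ _ e0)[n Hn]; exists n => m /Hn.
by rewrite subr0 => /(le_trans (ler_norm _)).
Qed.

Lemma half_pow_sum (n m : nat) :
  \sum_(n <= k < m) (2^-1 : R) ^+ k <= 2 * 2^-1 ^+ n.
Proof.
have h0 k : 0 <= (2^-1 : R) ^+ k by rewrite exprn_ge0// invr_ge0.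
have [nm|mn] := leqP n m; last by rewrite big_geq ?mulr_ge0// ltnW.
(* Subtracting the tail turns the bound into one that induction on [m] preserves. *)
suff : \sum_(n <= k < m) (2^-1 : R) ^+ k <= 2 * 2^-1 ^+ n - 2 * 2^-1 ^+ m.
  by move=> /le_trans; apply; rewrite gerBl mulr_ge0.
elim: m nm => [|m IH]; first by rewrite leqn0 => /eqP ->; rewrite big_geq// subrr.
rewrite leq_eqVlt => /predU1P[->|nm]; first by rewrite big_geq// subrr.
rewrite big_nat_recr//=; apply: le_trans (lerD (IH nm) (lexx _)) _.
by rewrite exprS; lra.
Qed.

End SequenceLimits.

(** * Partial sums of formal expansions *)

Section Expansions.
Variables (R : realType) (X : normedModType R).
Implicit Types (a b : nat -> R) (e u v : nat -> X).

Lemma expansionE a e N : expansion a e N = \sum_(0 <= i < N) a i *: e i.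
Proof. by []. Qed.

Lemma expansionS a e N : expansion a e N.+1 = expansion a e N + a N *: e N.
Proof. by rewrite !expansionE big_nat_recr. Qed.

Lemma eq_expansion a b e N : (forall i, (i < N)%N -> a i = b i) ->
  expansion a e N = expansion b e N.
Proof. by move=> H; apply: eq_big_nat => i /andP[_ iN]; rewrite H. Qed.

Lemma expansion0 e : expansion (fun=> 0) e = cst 0.
Proof.
by apply/funext => N; rewrite expansionE big1// => i _; rewrite scale0r.
Qed.

Lemma expansionB a b e N :
  expansion (fun i => a i - b i) e N = expansion a e N - expansion b e N.
Proof.
by rewrite !expansionE -sumrB; apply: eq_bigr => i _; rewrite scalerBl.
Qed.

Lemma expansionZ k a e N :
  expansion (fun i => k * a i) e N = k *: expansion a e N.
Proof.
by rewrite !expansionE scaler_sumr; apply: eq_bigr => i _; rewrite scalerA.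
Qed.

Lemma expansion_sum (F : nat -> nat -> R) e N n :
  expansion (fun i => \sum_(0 <= k < n) F k i) e N =
  \sum_(0 <= k < n) expansion (F k) e N.
Proof.
rewrite /expansion /series /= exchange_big /=; apply: eq_bigr => i _.
by rewrite scaler_suml.
Qed.

Definition truncate (n : nat) a : nat -> R :=
  fun i => if (i < n)%N then a i else 0.

Lemma expansion_truncate n a e N :
  expansion (truncate n a) e N = expansion a e (minn n N).
Proof.
elim: N => [|N IH]; first by rewrite minn0 !expansionE !big_geq.
rewrite expansionS IH /truncate; have [Nn|Nn] := ltnP N n.
  by rewrite (minn_idPr Nn) expansionS.
by rewrite scale0r addr0 (minn_idPl (leqW Nn)).
Qed.

(** Only finite sums occur, so the notion also applies to subsequences of a basis, which need not be
    bases of [X]. *)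
Definition has_basis_constant e (B : R) : Prop :=
  forall a N M, (N <= M)%N -> `|expansion a e N| <= B * `|expansion a e M|.

End Expansions.

(** * Uniform boundedness of the partial sum projections *)

Section BasisConstant.
Variables (R : realType) (X : completeNormedModType R) (e : nat -> X).
Hypothesis basis : schauder_basis e.

(** The least such [b] is the auxiliary norm of [x], the supremum of the norms of its partial sums.
    The aim is to dominate it by the norm of [x]. *)
Let bounded_expansion (x : X) (a : nat -> R) (b : R) : Prop :=
  expansion a e @ \oo --> x /\ forall N, `|expansion a e N| <= b.

Let bounded_expansion0 : bounded_expansion 0 (fun=> 0) 0.
Proof.
rewrite /bounded_expansion expansion0; split; first exact: cvg_cst.
by move=> N; rewrite normr0.
Qed.

Let bounded_expansionB x y a a' b b' :
  bounded_expansion x a b -> bounded_expansion y a' b' ->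
  bounded_expansion (x - y) (fun i => a i - a' i) (b + b').
Proof.
move=> [xa xb] [ya yb]; split.
  have -> : expansion (fun i => a i - a' i) e = expansion a e \- expansion a' e.
    by apply/funext => N; rewrite expansionB.
  exact: cvgB.
by move=> N; rewrite expansionB (le_trans (ler_normB _ _))// lerD.
Qed.

Let bounded_expansionZ k x a b :
  bounded_expansion x a b ->
  bounded_expansion (k *: x) (fun i => k * a i) (`|k| * b).
Proof.
move=> [xa xb]; split.
  have -> : expansion (fun i => k * a i) e = k \*: expansion a e.
    by apply/funext => N; rewrite expansionZ.
  by apply: cvgZ => //; exact: cvg_cst.
by move=> N; rewrite expansionZ normrZ ler_wpM2l.
Qed.

Lemma schauder_basis_neq0 i : e i != 0.
Proof.
apply/eqP => ei0.
have [a [a0 au]] := basis 0.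
have z0 : expansion (fun=> 0) e @ \oo --> (0 : X).
  by rewrite expansion0; exact: cvg_cst.
have z1 : expansion (fun j => (j == i)%:R) e @ \oo --> (0 : X).
  have -> : expansion (fun j => (j == i)%:R) e = cst 0.
    apply/funext => N; rewrite expansionE big1// => j _.
    by case: eqP => [->|_]; rewrite ?ei0 ?scaler0 ?scale0r.
  exact: cvg_cst.
have := congr1 (@^~ i) (etrans (esym (au _ z0)) (au _ z1)).
by rewrite eqxx => /esym/eqP; rewrite oner_eq0.
Qed.

Let approximate_expansion : exists2 c : R, 0 <= c &
  forall x eps, 0 < eps -> exists y a,
    bounded_expansion y a (c * `|x|) /\ `|x - y| <= eps.
Proof.
pose F (m : nat) := [set x : X | exists a, bounded_expansion x a m%:R].
(* Otherwise Baire yields a point outside every [closure (F i)], although its own expansion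
   converges and hence has bounded partial sums. *)
have [m Fm] : exists m, ~ dense (~` closure (F m)).
  apply/existsNP => H.
  have /Baire : forall i, open (~` closure (F i)) /\ dense (~` closure (F i)).
    by move=> i; split; [exact/closed_openC/closed_closure|exact: H].
  move=> /(_ setT)[]; [by exists 0|exact: openT|move=> x [_ xF]].
  have [a [xa _]] := basis x.
  have [M Mb] : exists M : R, forall N, `|expansion a e N| <= M.
    have /cvg_seq_bounded[M [Mr Mb]] : cvgn (expansion a e) by apply/cvg_ex; exists x.
    by exists (M + 1) => N; apply: Mb => //; rewrite ltrDl.
  apply: (xF (Num.truncn M).+1 I); apply: subset_closure; exists a.
  by split=> // N; apply: le_trans (Mb N) (ltW (truncnS_gt _)).
have [x0 [r r0 x0F]] : exists x0, exists2 r : R, 0 < r & ball x0 r `<=` closure (F m).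
  move: Fm; rewrite /dense => /existsNP[U].
  move=> /not_implyP[[x0 Ux0]] /not_implyP[Uo UF].
  have /nbhs_ballP[r /= r0 rU] := open_nbhs_nbhs (conj Uo Ux0).
  exists x0, r => // y /rU Uy; apply: contrapT => yF; apply: UF.
  by exists y.
(* The ball around [x0] is moved to the origin by subtracting an approximation of [x0] from one of
   [x0 + x], which doubles the bound [m]. *)
have near0 x eps : `|x| < r -> 0 < eps -> exists y a,
    bounded_expansion y a (m%:R + m%:R) /\ `|x - y| <= eps.
  move=> xr e0.
  have e20 : 0 < eps / 2 by rewrite divr_gt0.
  have [|y1 [[a1 E1] /=]] := x0F (x0 + x) _ _ (nbhsx_ballx _ _ e20).
    by rewrite -ball_normE /ball_ /= opprD addrA subrr sub0r normrN.
  rewrite -ball_normE /ball_ /= => d1.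
  have [|y2 [[a2 E2] /=]] := x0F x0 _ _ (nbhsx_ballx _ _ e20).
    exact: ballxx.
  rewrite -ball_normE /ball_ /= => d2.
  exists (y1 - y2); exists (fun i => a1 i - a2 i); split.
    exact: bounded_expansionB.
  have -> : x - (y1 - y2) = (x0 + x - y1) - (x0 - y2).
    by rewrite !opprB -(addrA x0) (addrC y2 (- x0)) addrACA subrr add0r (addrC y2) addrA.
  rewrite (le_trans (ler_normB _ _))//; lra.
exists ((m%:R + m%:R) * (2 / r)); first by rewrite mulr_ge0// ?addr_ge0// divr_ge0// ltW.
move=> x eps e0.
have [->|x0'] := eqVneq x 0.
  exists 0; exists (fun=> 0); split; last by rewrite subrr normr0 ltW.
  rewrite normr0 mulr0.
  exact: bounded_expansion0.
have nx : 0 < `|x| by rewrite normr_gt0.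
(* Dividing by [t] gives [x] norm [r / 2], inside the ball; scaling back multiplies bound and
   tolerance by [t]. *)
pose t := 2 * `|x| / r.
have t0 : 0 < t by rewrite divr_gt0// mulr_gt0.
have [| |y [a [ya yx]]] := near0 (t^-1 *: x) (eps / t).
- rewrite normrZ gtr0_norm ?invr_gt0// mulrC ltr_pdivrMr//.
  rewrite /t [ltRHS]mulrC divfK ?gt_eqF//; lra.
- by rewrite divr_gt0.
exists (t *: y); exists (fun i => t * a i); split.
  have -> : (m%:R + m%:R) * (2 / r) * `|x| = `|t| * (m%:R + m%:R) :> R.
    by rewrite gtr0_norm// /t; field; rewrite gt_eqF.
  exact: bounded_expansionZ.
have -> : x - t *: y = t *: (t^-1 *: x - y).
  by rewrite scalerBr scalerA divff ?gt_eqF// scale1r.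
by rewrite normrZ gtr0_norm// mulrC -ler_pdivlMr.
Qed.

(* The successive approximation step of the open mapping theorem: the
   residuals of repeated approximate expansions decay geometrically. *)
Let bounded_full_expansion : exists c : R,
  forall x, exists a, bounded_expansion x a (c * `|x|).
Proof.
have [c c0 /= H] := approximate_expansion.
exists (2 * c) => x.
have [->|x0] := eqVneq x 0.
  have [y [a [_ yx]]] := H 0 1 ltr01.
  exists (fun i => a i - a i).
  have -> : (fun i : nat => a i - a i) = fun=> 0.
    by apply/funext => i; rewrite subrr.
  rewrite normr0 mulr0; exact: bounded_expansion0.
have nx : 0 < `|x| by rewrite normr_gt0.
have {H} /choice[f fH] : forall p : X * nat, exists q : X * (nat -> R),
    bounded_expansion q.1 q.2 (c * `|p.1|) /\
    `|p.1 - q.1| <= `|x| * 2^-1 ^+ p.2.+1.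
  move=> [y n]; have [|z [a za]] := H y (`|x| * 2^-1 ^+ n.+1).
    by rewrite mulr_gt0// exprn_gt0// invr_gt0.
  by exists (z, a).
(* [r n] is what remains of [x] after [n] approximations, and [S n] collects the coefficients used
   so far. *)
pose fix r n := if n is k.+1 then r k - (f (r k, k)).1 else x.
pose a k := (f (r k, k)).2.
pose S n i := \sum_(0 <= k < n) a k i.
have rle n : `|r n| <= `|x| * 2^-1 ^+ n.
  case: n => [|n]; first by rewrite expr0 mulr1.
  exact: (fH (r n, n)).2.
have Sr n : expansion (S n) e @ \oo --> x - r n.
  elim: n => [|n IH] /=.
    rewrite subrr; have -> : expansion (S 0%N) e = cst 0; last exact: cvg_cst.
    apply/funext => N; rewrite expansionE big1// => j _.
    by rewrite /S big_geq// scale0r.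
  have -> : expansion (S n.+1) e = expansion (S n) e \+ expansion (a n) e.
    by apply/funext => N /=; rewrite !expansion_sum big_nat_recr.
  rewrite opprB addrCA addrC; apply: cvgD => //.
  exact: (fH (r n, n)).1.1.
have Sdiff n m N : (n <= m)%N ->
    `|expansion (S m) e N - expansion (S n) e N| <= 2 * c * `|x| * 2^-1 ^+ n.
  move=> nm; rewrite !expansion_sum (@big_cat_nat _ _ _ n 0 m)//= addrAC subrr add0r.
  apply: le_trans (ler_norm_sum _ _ _) _.
  apply: (@le_trans _ _ (\sum_(n <= k < m) c * `|x| * 2^-1 ^+ k)).
    apply: ler_sum => k _; apply: le_trans ((fH (r k, k)).1.2 N) _.
    rewrite -mulrA ler_wpM2l//; exact: rle.
  rewrite -mulr_sumr (mulrC 2) -!mulrA ler_wpM2l// (mulrCA 2) ler_wpM2l//.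
  exact: half_pow_sum.
(* A single term is a difference of two consecutive partial sums, whence the extra factor 2.
   Dividing by the norm of [e i] makes the coefficients Cauchy. *)
have /choice[al alH] : forall i, exists l : R, (fun n => S n i) @ \oo --> l.
  move=> i; apply/cvg_ex; apply: cvgn_cauchy => eps e0.
  have ei : 0 < `|e i| by rewrite normr_gt0 schauder_basis_neq0.
  have [n Hn] := half_pow_small (2 * (2 * c * `|x|)) (mulr_gt0 e0 ei).
  exists n => m nm; rewrite -(ler_pM2r ei) -normrZ scalerBl.
  apply: le_trans (Hn n (leqnn _)); rewrite -mulrA mulr_natl mulr2n.
  have -> : S m i *: e i - S n i *: e i =
      (expansion (S m) e i.+1 - expansion (S n) e i.+1) -
      (expansion (S m) e i - expansion (S n) e i).
    by rewrite -!expansionB expansionS addrAC subrr add0r scalerBl.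
  by apply: le_trans (ler_normB _ _) _; rewrite lerD// Sdiff.
have aN N : (fun n => expansion (S n) e N) @ \oo --> expansion al e N.
  elim: N => [|N IH].
    have -> : (fun n => expansion (S n) e 0) = cst 0.
      by apply/funext => n; rewrite expansionE big_geq.
    by rewrite expansionE big_geq//; exact: cvg_cst.
  have -> : (fun n => expansion (S n) e N.+1) =
      (fun n => expansion (S n) e N) \+ (fun n => S n N *: e N).
    by apply/funext => n; rewrite expansionS.
  rewrite expansionS; apply: cvgD => //; apply: cvgZ; last exact: cvg_cst.
  exact: alH.
have adiff n N : `|expansion al e N - expansion (S n) e N| <=
    2 * c * `|x| * 2^-1 ^+ n.
  by apply: (@cvgn_dist_le _ _ _ _ _ n) (aN N) _ => m /Sdiff.
(* Since [S 0] vanishes, [adiff] at 0 bounds the partial sums. For convergence, [eps] is split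
   between [adiff], the convergence of [S n], and the residual [r n]. *)
exists al; split; last first.
  move=> N; have := adiff 0%N N; rewrite expr0 mulr1.
  by rewrite [expansion (S 0%N) e N]expansion_sum big_geq// subr0.
apply/cvgnP => eps e0.
have e30 : 0 < eps / 3 by rewrite divr_gt0.
have [n1 Hn1] := half_pow_small (2 * c * `|x|) e30.
have [n2 Hn2] := half_pow_small `|x| e30.
pose n := maxn n1 n2.
have /cvgnP/(_ _ e30)[M HM] := Sr n.
exists M => N /HM H1.
have H2 := le_trans (adiff n N) (Hn1 _ (leq_maxl _ _)).
have H3 := le_trans (rle n) (Hn2 _ (leq_maxr _ _)).
apply: le_trans (ler_distD (expansion (S n) e N) _ _) _.
apply: le_trans (lerD (lexx _) (ler_distD (x - r n) _ _)) _.
have -> : x - r n - x = - r n by rewrite addrAC subrr add0r.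
rewrite normrN; lra.
Qed.

(** The truncation of [a] at [M] expands the finite sum up to [M]. By uniqueness it is the expansion
    with bounded partial sums, which include the one up to [N]. *)
Lemma schauder_basis_constant : exists B, has_basis_constant e B.
Proof.
have [c Hc] := bounded_full_expansion; exists c => a N M NM.
have [b [bx bb]] := Hc (expansion a e M).
have tx : expansion (truncate M a) e @ \oo --> expansion a e M.
  apply/cvgnP => eps e0; exists M => m Mm.
  by rewrite expansion_truncate (minn_idPl Mm) subrr normr0 ltW.
have [a0 [_ au]] := basis (expansion a e M).
have ab : truncate M a = b by rewrite -(au _ tx) (au _ bx).
have := bb N; rewrite -ab expansion_truncate.
by rewrite (minn_idPr NM).
Qed.

End BasisConstant.

(** * The gliding hump construction *)

Section GlidingHump.
Variables (R : realType) (X : completeNormedModType R).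
Variables (u v : nat -> X) (B : R).
Hypothesis uB : has_basis_constant u B.
Hypothesis u_neq0 : forall i, u i != 0.

Let basis_constant_ge1 : 1 <= B.
Proof.
have := uB (fun=> 1) (leqnn 1).
rewrite !expansionE big_nat1 scale1r => H.
by rewrite -(ler_pM2r (_ : 0 < `|u 0%N|)) ?mul1r// normr_gt0.
Qed.

Let coef_le a i N : (i < N)%N ->
  `|a i| * `|u i| <= 2 * B * `|expansion a u N|.
Proof.
move=> iN; rewrite -normrZ.
have -> : a i *: u i = expansion a u i.+1 - expansion a u i.
  by rewrite expansionS addrAC subrr add0r.
apply: le_trans (ler_normB _ _) _.
by rewrite -mulrA mulr_natl mulr2n lerD// uB// ltnW.
Qed.

Let H n := \sum_(0 <= i < n) 2 * B * (`|v i| / `|u i|).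

Let initial_bound a n N : (n <= N)%N ->
  `|expansion a v n| <= H n * `|expansion a u N|.
Proof.
move=> nN; apply: le_trans (ler_norm_sum _ _ _) _.
rewrite /H mulr_suml big_nat [leRHS]big_nat; apply: ler_sum => i /andP[_ i_n].
have ui : 0 < `|u i| by rewrite normr_gt0.
have -> : 2 * B * (`|v i| / `|u i|) * `|expansion a u N| =
    2 * B * `|expansion a u N| / `|u i| * `|v i|.
  by field; rewrite gt_eqF.
by rewrite normrZ ler_wpM2r// ler_pdivlMr// coef_le// (leq_trans i_n).
Qed.

Hypothesis unbounded :
  forall K, exists a N, K * `|expansion a u N| < `|expansion a v N|.

(** One hump: the terms below [n] are controlled by [H n], so a large ratio between the [v] and [u]
    norms must come from later terms, which are then normalised along [v]. *)
Let tail n : exists p : (nat -> R) * nat,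
  [/\ (n < p.2)%N, forall i, (i < n)%N || (p.2 <= i)%N -> p.1 i = 0,
    forall L, `|expansion p.1 u L| <= 2^-1 ^+ n &
    1 <= `|expansion p.1 v p.2|].
Proof.
pose h : R := 2^-1 ^+ n.
have h0 : 0 < h by rewrite exprn_gt0// invr_gt0.
have B0 : 0 < B by apply: lt_le_trans basis_constant_ge1.
(* [H n] pays for the removed head. The rest makes the tail exceed [2 * B * eta / h] along [v],
   while its partial sums along [u] are at most [2 * B * eta]. *)
have [a [N]] := unbounded (H n + 2 * B / h).
set eta := `|expansion a u N| => Ha.
have eta0 : 0 <= eta by exact: normr_ge0.
have K0 : 0 <= 2 * B / h * eta by rewrite !mulr_ge0// ?invr_ge0 ltW.
have nN : (n < N)%N.
  rewrite ltnNge; apply/negP => Nn.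
  have := @initial_bound (truncate N a) n n (leqnn n).
  rewrite !expansion_truncate (minn_idPl Nn) -/eta.
  by rewrite mulrDl in Ha; lra.
pose b0 i := truncate N a i - truncate n a i.
have b0E w L : expansion b0 w L = expansion a w (minn N L) - expansion a w (minn n L).
  by rewrite expansionB !expansion_truncate.
pose D := `|expansion b0 v N|.
have HD : 2 * B / h * eta < D.
  rewrite /D b0E minnn (minn_idPl (ltnW nN)).
  have := @initial_bound a n N (ltnW nN); rewrite -/eta.
  have := lerB_normD (expansion a v N) (- expansion a v n).
  by rewrite normrN; rewrite mulrDl in Ha; lra.
have D0 : 0 < D by apply: le_lt_trans HD.
exists (fun i => D^-1 * b0 i, N); split => //=.
- move=> i Hi; rewrite /b0 /truncate; case: ltnP => iN; last first.
    by rewrite ltnNge (leq_trans (ltnW nN) iN) subrr mulr0.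
  by move: Hi; rewrite (leqNgt N) iN orbF => ->; rewrite subrr mulr0.
- move=> L; rewrite expansionZ normrZ gtr0_norm ?invr_gt0// mulrC ler_pdivrMr//.
  apply: (@le_trans _ _ (2 * B * eta)).
    rewrite b0E; apply: le_trans (ler_normB _ _) _.
    rewrite -mulrA mulr_natl mulr2n lerD// uB ?geq_minl//.
    by rewrite geq_min (ltnW nN).
  by move: HD => /ltW; rewrite mulrAC ler_pdivrMr// (mulrC D).
- by rewrite expansionZ normrZ -/D gtr0_norm ?invr_gt0// mulVf// gt_eqF.
Qed.

(** Humps on consecutive intervals are added up. Along [u] they are geometrically small, and along
    [v] each one moves the partial sum by at least 1. *)
Lemma gliding_hump : exists a, cvgn (expansion a u) /\ ~ cvgn (expansion a v).
Proof.
have [f fH] := choice tail.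
pose Nk k := iter k (fun n => (f n).2) 0%N.
have NkS k : (Nk k < Nk k.+1)%N by have [] := fH (Nk k).
have Nk_mono k l : (k <= l)%N -> (Nk k <= Nk l)%N.
  move=> kl; rewrite -(subnKC kl); elim: (l - k)%N => [|d IH]; first by rewrite addn0.
  by rewrite addnS (leq_trans IH)// ltnW.
have Nk_ge k : (k <= Nk k)%N by elim: k => // k IH; exact: leq_ltn_trans (NkS k).
pose b k := (f (Nk k)).1.
have b0 k i : (i < Nk k)%N || (Nk k.+1 <= i)%N -> b k i = 0.
  by have [_ + _ _] := fH (Nk k); exact.
(* Hump [k] starts at [Nk k], which is at least [k], so only those with [k <= i] can reach index
   [i]. *)
pose a i := \sum_(0 <= k < i.+1) b k i.
have aE i K : (i < K)%N -> a i = \sum_(0 <= k < K) b k i.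
  move=> iK; rewrite (@big_cat_nat _ _ _ i.+1 0 K)//= [X in _ + X]big_nat [X in _ + X]big1 ?addr0//.
  by move=> k /andP[ik _]; rewrite b0// (leq_trans ik).
have exp_aE (w : nat -> X) L K : (L <= K)%N ->
    expansion a w L = \sum_(0 <= k < K) expansion (b k) w L.
  move=> LK; rewrite -expansion_sum; apply: eq_expansion => i iL.
  by rewrite (aE _ K)// (leq_trans iL).
have exp_b0 (w : nat -> X) k L : (L <= Nk k)%N -> expansion (b k) w L = 0.
  move=> Lk; rewrite expansionE big_nat big1// => i /andP[_ iL].
  by rewrite b0 ?scale0r// (leq_trans iL).
have exp_b (w : nat -> X) k L : (Nk k.+1 <= L)%N -> expansion (b k) w L = expansion (b k) w (Nk k.+1).
  move=> kL; rewrite !expansionE (@big_cat_nat _ _ _ (Nk k.+1) 0 L)//=.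
  rewrite [X in _ + X]big_nat [X in _ + X]big1 ?addr0// => i /andP[ki _].
  by rewrite b0 ?scale0r// ki orbT.
(* Humps before [n] are complete at [Nk n] and cancel; the others have not started there. *)
have diff (w : nat -> X) n m : (Nk n <= m)%N -> expansion a w m - expansion a w (Nk n) =
    \sum_(n <= k < m) expansion (b k) w m.
  move=> nm; rewrite (exp_aE w m m)// (exp_aE w (Nk n) m)// -sumrB.
  rewrite (@big_cat_nat _ _ _ n 0 m) ?(leq_trans (Nk_ge n))//=.
  rewrite big_nat big1 ?add0r; last first.
    move=> k /andP[_ kn]; rewrite (exp_b w k m) ?(leq_trans _ nm) ?Nk_mono//.
    by rewrite (exp_b w k (Nk n)) ?subrr// Nk_mono.
  rewrite big_nat [RHS]big_nat; apply: eq_bigr => k /andP[nk _].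
  by rewrite (exp_b0 w k (Nk n)) ?subr0// Nk_mono.
exists a; split.
  apply: cvgn_cauchy => eps e0; have [n Hn] := half_pow_small 2 e0.
  exists (Nk n) => m nm; rewrite diff//; apply: le_trans (Hn n (leqnn n)).
  apply: le_trans (half_pow_sum R n m); apply: le_trans (ler_norm_sum _ _ _) _.
  apply: ler_sum => k _; have [_ _ + _] := fH (Nk k) => /(_ m) /le_trans; apply.
  by apply: ler_wiXn2l; [lra|lra|exact: Nk_ge].
(* Two partial sums within 1/3 of [l] are less than 1 apart, but hump [n] separates those at [Nk n]
   and [Nk n.+1] by at least 1. *)
move=> /cvg_ex[l /cvgnP/(_ (1 / 3))[|n Hn]]; first by rewrite divr_gt0.
have := diff v n (Nk n.+1) (ltnW (NkS n)).
rewrite big_ltn; last exact: leq_ltn_trans (Nk_ge n) (NkS n).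
rewrite [X in _ = _ + X]big_nat [X in _ = _ + X]big1 ?addr0; last first.
  by move=> k /andP[nk _]; rewrite exp_b0// Nk_mono.
move=> dv; have [_ _ _] := fH (Nk n); rewrite -/(Nk n.+1) -/(b n) -dv.
have := Hn _ (Nk_ge n); have := Hn _ (leq_trans (leqnSn n) (Nk_ge n.+1)).
have := ler_distD l (expansion a v (Nk n.+1)) (expansion a v (Nk n)).
rewrite (distrC l); lra.
Qed.

End GlidingHump.

Lemma dominated_expansions (R : realType) (X : completeNormedModType R)
    (u v : nat -> X) (B : R) :
  has_basis_constant u B -> (forall i, u i != 0) ->
  (forall a, cvgn (expansion a u) -> cvgn (expansion a v)) ->
  exists K, forall a N, `|expansion a v N| <= K * `|expansion a u N|.
Proof.
move=> uB u0 uv; apply: contrapT => /forallNP H.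
have [|a [/uv]] := @gliding_hump _ _ u v B uB u0; last by [].
move=> K; have /existsNP[a /existsNP[N HN]] := H K.
by exists a, N; rewrite ltNge; apply/negP.
Qed.

(** * Subsequences of a subsymmetric basis *)

Lemma subsequence_basis_constant (R : realType) (X : normedModType R)
    (e : nat -> X) (B : R) (s : nat -> nat) :
  {homo s : i j / (i < j)%N} ->
  has_basis_constant e B -> has_basis_constant (e \o s) B.
Proof.
move=> hs eB a N M NM.
have s_inj : injective s.
  move=> i j; case: (ltngtP i j) => // /hs ij sij; by rewrite sij ltnn in ij.
have s_ge i : (i <= s i)%N.
  by elim: i => // i IH; apply: leq_ltn_trans IH (hs _ _ (ltnSn i)).
(* [b] carries [a] along [s] and vanishes off its range. The sum may stop at [j] because
   [i <= s i]. *)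
pose b j := \sum_(0 <= i < j.+1 | s i == j) a i.
have bs i : b (s i) = a i.
  rewrite /b (eq_bigl (pred1 i)); last by move=> k /=; rewrite (inj_eq s_inj).
  by rewrite big_nat1_eq /= ltnS s_ge.
have b0 j : (forall i, s i <> j) -> b j = 0.
  by move=> H; rewrite /b big1// => i /eqP /H.
have bE K : expansion b e (s K) = expansion a (e \o s) K.
  elim: K => [|K IH].
    rewrite [RHS]expansionE big_geq// expansionE big_nat big1// => j /andP[_ j0].
    rewrite b0 ?scale0r// => i; case: i => [|i] sij; first by rewrite sij ltnn in j0.
    by have := ltn_trans j0 (hs 0%N i.+1 isT); rewrite sij ltnn.
  have sK := hs _ _ (ltnSn K).
  rewrite expansionS -IH !expansionE (@big_cat_nat _ _ _ (s K) 0 (s K.+1)) ?(ltnW sK)//=.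
  rewrite (@big_ltn _ _ _ (s K))// bs [X in _ + (_ + X)]big_nat [X in _ + (_ + X)]big1 ?addr0// => j /andP[Kj jK].
  rewrite b0 ?scale0r// => i sij; rewrite -sij in Kj jK.
  case: (leqP i K) => iK.
    move: iK; rewrite leq_eqVlt => /predU1P[iK|/hs]; first by rewrite iK ltnn in Kj.
    by rewrite ltnNge (ltnW Kj).
  move: iK; rewrite leq_eqVlt => /predU1P[iK|/hs]; first by rewrite -iK ltnn in jK.
  by rewrite ltnNge (ltnW jK).
rewrite -!bE; apply: eB; move: NM; rewrite leq_eqVlt => /predU1P[->//|/hs].
exact: ltnW.
Qed.

Lemma subsymmetric_subsequence (R : realType) (X : completeNormedModType R)
    (e : nat -> X) (s : nat -> nat) :
  subsymmetric e -> {homo s : i j / (i < j)%N} ->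
  exists K, [/\ 0 < K,
    forall a N, `|expansion a (e \o s) N| <= K * `|expansion a e N| &
    forall a N, `|expansion a e N| <= K * `|expansion a (e \o s) N|].
Proof.
move=> [[basis _] ess] hs.
have [B eB] := schauder_basis_constant basis.
have e0 := schauder_basis_neq0 basis.
have esB := subsequence_basis_constant hs eB.
have [K1 H1] : exists K, forall a N, `|expansion a (e \o s) N| <= K * `|expansion a e N|.
  by apply: dominated_expansions eB e0 _ => a /(ess _ hs).
have [K2 H2] : exists K, forall a N, `|expansion a e N| <= K * `|expansion a (e \o s) N|.
  apply: dominated_expansions esB _ _ => [i|a]; first exact: e0.
  by move=> /(ess _ hs).
exists (1 + `|K1| + `|K2|); split.
- by rewrite -addrA ltr_pwDl// addr_ge0.
- move=> a N; apply: le_trans (H1 a N) _; rewrite ler_wpM2r//.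
  by have := ler_norm K1; have := normr_ge0 K2; lra.
- move=> a N; apply: le_trans (H2 a N) _; rewrite ler_wpM2r//.
  by have := ler_norm K2; have := normr_ge0 K1; lra.
Qed.

(** * Countability of ranks *)

Lemma ole_total (a b : Ord) : ole a b \/ olt b a.
Proof.
elim: a b => T f IH [U g] /=.
have [H|/existsNP[i /forallNP H]] := pselect (forall i, exists j, ole (f i) (g j)).
  by left.
(* If [f i] is below no [g j], by induction every [g j] is strictly below [f i], which is what
   [ole b (f i)] means. *)
right; exists i; case: (f i) (IH i) H => V h IHi H /= j.
by case: (IHi (g j)) => // /H.
Qed.

Lemma ole_trans (a b c : Ord) : ole a b -> ole b c -> ole a c.
Proof.
elim: a b c => T f IH [U g] [V h] /= fg gh i.
by have [j /IH ij] := fg i; have [k /ij ik] := gh j; exists k.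
Qed.

Section CountableRank.
Variables (T : countType) (precT : T -> T -> Prop) (WT : wellfounded precT).

(** The ranks of elements of [T] form an initial segment of the ordinals, so a bounded set of
    ordinals below them is countable with [T]. *)
Lemma ole_rho (b : Ord) (t : T) :
  ole b (rho WT t) -> exists t', oeq b (rho WT t').
Proof.
elim/(well_founded_ind (wellfounded_Acc WT)): t => t IH bt.
have [tb|] := ole_total (rho WT t) b; first by exists t.
by rewrite {1}rhoE => -[[t' t't]] /= /IH; apply.
Qed.

(** By induction [N] does not lower ranks, so every ordinal below the rank of [prec] is the rank of
    some element of [T]. *)
Lemma countable_rank_map (S : Type) (prec : S -> S -> Prop) (N : S -> T) :
  (forall a b, prec a b -> precT (N a) (N b)) -> countable_rank prec.
Proof.
move=> NH.
have W : wellfounded prec.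
  by move=> [a Ha]; apply: WT; exists (N \o a) => n; exact: NH.
(* Numbers coding no element of [T] get the empty tree, the ordinal zero. *)
exists W; exists (fun n => if unpickle n is Some t then rho WT t else osup (False_rect Ord)).
move=> b [a ba].
have aN : ole (rho W a) (rho WT (N a)).
  elim/(well_founded_ind (wellfounded_Acc W)): a {ba} => a IH.
  rewrite !rhoE => -[y ya]; exists (exist _ (N y) (NH _ _ ya)); exact: IH.
have [t bt] := ole_rho (ole_trans ba aN).
by exists (pickle t); rewrite pickleK.
Qed.

End CountableRank.

(** * Coarse embeddings and coded combinations *)

Section CompleteSeparable.
Variables (R : realType) (E : metricType R).

Lemma separable_dense_sequence (x0 : E) : separable_metric E ->
  exists D : nat -> E, forall x eps, 0 < eps -> exists n, mdist (D n) x <= eps.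
Proof.
move=> [A [/countable_injP[f f_inj] dA]].
(* [x0] fills the indices that code no point of [A]. *)
exists (fun n => xget x0 [set y | A y /\ f y = n]) => x eps eps0.
have [|y [xy Ay]] := dA (interior (ball x eps)) _ (open_interior _).
  by exists x; exact: nbhsx_ballx.
exists (f y); case: xgetP => [z _ [Az fz]|/(_ y) []//].
have -> : z = y by apply: f_inj; rewrite ?inE.
by move: (interior_subset xy); rewrite ballEmdist /= metric_sym => /ltW.
Qed.

Lemma complete_cauchy_sequence (u : nat -> E) : complete_metric E ->
  (forall eps, 0 < eps ->
    exists n, forall m, (n <= m)%N -> mdist (u n) (u m) < eps) ->
  exists l, forall eps, 0 < eps ->
    exists n, forall m, (n <= m)%N -> mdist l (u m) <= eps.
Proof.
move=> EC H; have [|l ul] := EC (u @ \oo) _.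
  apply: cauchy_exP => eps /H[n Hn]; exists (u n), n => // m /Hn.
  by rewrite ballEmdist.
exists l => eps eps0; have [n _ Hn] := ul _ (nbhsx_ballx l eps eps0).
by exists n => m /Hn; rewrite /= ballEmdist => /ltW.
Qed.

Lemma complete_geometric_sequence (u : nat -> E) (n0 : nat) : complete_metric E ->
  (forall n, (n0 <= n)%N -> mdist (u n) (u n.+1) <= 2 * 2^-1 ^+ n) ->
  exists l, forall eps, 0 < eps ->
    exists n, forall m, (n <= m)%N -> mdist l (u m) <= eps.
Proof.
move=> EC H; apply: complete_cauchy_sequence => // eps eps0.
have e20 : 0 < eps / 2 by rewrite divr_gt0.
(* The steps from [n] on sum to at most 4 times [2^-1 ^+ n]; halving [eps] makes the inequality
   strict. *)
have [k Hk] := half_pow_small 4 e20; exists (maxn n0 k) => m nm.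
set n := maxn n0 k in nm *.
have : mdist (u n) (u m) <= \sum_(n <= i < m) 2 * 2^-1 ^+ i.
  elim: m nm => [|m IH].
    by rewrite leqn0 => /eqP ->; rewrite big_geq// mdistxx.
  rewrite leq_eqVlt => /predU1P[<-|]; first by rewrite big_geq// mdistxx.
  rewrite ltnS => nm; rewrite big_nat_recr//=; apply: le_trans (metric_triangle _ (u m) _) _.
  by rewrite lerD ?IH// H// (leq_trans _ nm)// leq_maxl.
rewrite -mulr_sumr => /le_lt_trans; apply.
have := half_pow_sum R n m; have := Hk n (leq_maxr _ _).
lra.
Qed.

End CompleteSeparable.

Section CoarseEmbeddings.
Variables (R : realType) (X : normedModType R) (A : set X) (E : metricType R).

Lemma coarse_embedding_bounds (phi : A -> E) (x0 : A) :
  (forall m : nat, exists b : R, forall x y,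
    norm_dist x y <= m.+1%:R -> mdist (phi x) (phi y) <= b) ->
  (forall m : nat, exists b : R, forall x y,
    b <= norm_dist x y -> m%:R <= mdist (phi x) (phi y)) ->
  coarse_embedding (@norm_dist R X A) phi.
Proof.
move=> Hup Hlow; split; last split; last split.
- split=> [r|r s rs].
    by apply: le_ereal_inf_tmp => _ [p _ <-]; rewrite lee_fin mdist_ge0.
  by apply: ereal_inf_le_tmp => _ [p /= ps <-]; exists p => //=; apply: le_trans ps.
- split=> [r|r s rs].
    (* The pair [(x0, x0)] keeps the supremum from being empty, hence negative. *)
    apply: ereal_sup_ubound; exists (x0, x0); last by rewrite mdistxx.
    by rewrite /= /norm_dist subrr normr0 ltW// Zset_gt0.
  by apply: ereal_sup_le => _ [p /= ps <-]; exists p => //=; apply: le_trans rs.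
- move=> r; have [b Hb] := Hup (Num.truncn (val r)).
  apply: le_lt_trans (ltry b); apply: ge_ereal_sup => _ [p /= pr <-].
  by rewrite lee_fin Hb// (le_trans pr)// ltW// truncnS_gt.
- apply/cvgeyPge => K; have [b Hb] := Hlow (Num.truncn K).+1.
  exists (Num.truncn b) => // n /= bn; apply: le_ereal_inf_tmp => _ [p /= pr <-].
  rewrite lee_fin (le_trans (ltW (truncnS_gt K)))// Hb// (le_trans _ pr)//.
  by rewrite (le_trans (ltW (truncnS_gt b)))// ler_nat ltnS.
Qed.

End CoarseEmbeddings.

Lemma M_coarse_upper (R : realType) (w : Zset R -> \bar R) :
  (forall r, (w r < +oo)%E) -> modulus w ->
  exists F : nat -> nat, forall m, (w (Znat R m) <= (F m)%:R%:E)%E.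
Proof.
move=> wfin [w0 _].
exists (fun m => (Num.truncn (fine (w (Znat R m)))).+1) => m.
have wm : w (Znat R m) \is a fin_num by rewrite ge0_fin_numE.
by rewrite -[leLHS]fineK// lee_fin ltW// truncnS_gt.
Qed.

Lemma M_coarse_lower (R : realType) (k : Zset R -> \bar R) :
  (fun n => k (Znat R n)) @ \oo --> +oo%E ->
  exists G : nat -> nat, forall m, (m%:R%:E <= k (Znat R (G m)))%E.
Proof.
move=> /cvgeyPge kG.
suff /choice[G HG] : forall m : nat, exists g : nat, (m%:R%:E <= k (Znat R g))%E by exists G.
by move=> m; have [n _ Hn] := kG m%:R; exists n; exact: Hn (leqnn n).
Qed.

Section Combinations.
Variables (R : realType) (X : normedModType R) (q : nat -> R).
Implicit Types (f : nat -> X) (w : seq (nat * nat)).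

(* A pair [(k, i)] in [w] codes the term [q k *: f i]. *)
Definition combination f w : X := \sum_(p <- w) q p.1 *: f p.2.

Definition indices_below (k : nat) w : bool := all (fun p => p.2 < k)%N w.

Lemma indices_below_leq k l w : (k <= l)%N ->
  indices_below k w -> indices_below l w.
Proof. by move=> kl; apply: sub_all => p /leq_trans; apply. Qed.

Lemma indices_below_ex w : exists k, indices_below k w.
Proof.
elim: w => [|p w [k IH]]; first by exists 0%N.
exists (maxn p.2.+1 k); rewrite /indices_below /= leq_maxl /=.
by apply: indices_below_leq IH; rewrite leq_maxr.
Qed.

Lemma eq_combination f g w k : indices_below k w ->
  (forall i, (i < k)%N -> f i = g i) -> combination f w = combination g w.
Proof.
move=> /allP wk fg; rewrite /combination big_seq [RHS]big_seq.
by apply: eq_bigr => p /wk pk; rewrite fg.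
Qed.

(** The coefficients do not depend on [f], so estimates between expansions along two sequences carry
    over to codes read along both. *)
Lemma combination_expansion w : exists a N, forall f M, (N <= M)%N ->
  combination f w = expansion a f M.
Proof.
elim: w => [|p w [a [N IH]]].
  by exists (fun=> 0), 0%N => f M _; rewrite expansion0 /combination big_nil.
exists (fun i => (if i == p.2 then q p.1 else 0) + a i), (maxn p.2.+1 N) => f M NM.
rewrite /combination big_cons -/(combination f w) (IH f M); last first.
  by rewrite (leq_trans _ NM)// leq_maxr.
rewrite !expansionE [RHS](eq_bigr (fun i => (if i == p.2 then q p.1 else 0) *: f i + a i *: f i)).
  rewrite big_split /=; congr (_ + _).
  rewrite (bigD1_seq p.2) ?iota_uniq//=; last first.
    by rewrite mem_index_iota (leq_trans _ NM)// leq_maxl.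
  by rewrite eqxx big1 ?addr0// => i /negPf ->; rewrite scale0r.
by move=> i _; rewrite scalerDl.
Qed.

Lemma combinationB_expansion w w' : exists a N, forall f,
  combination f w - combination f w' = expansion a f N.
Proof.
have [a [N aE]] := combination_expansion w.
have [a' [N' aE']] := combination_expansion w'.
exists (fun i => a i - a' i), (maxn N N') => f.
by rewrite expansionB -aE ?leq_maxl// -aE' ?leq_maxr.
Qed.

Lemma combination_rspan (A : set X) f w : (forall p, p \in w -> A (f p.2)) ->
  rspan (range q) A (combination f w).
Proof.
move=> wA; exists (size w), (fun i => q (nth (0, 0)%N w i).1),
  (fun i => f (nth (0, 0)%N w i).2); split.
  by move=> i; split; [exists (nth (0, 0)%N w i).1|apply: wA; rewrite mem_nth].
by rewrite /combination (big_nth (0, 0)%N) big_mkord.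
Qed.

Lemma rspan_combination f x : rspan (range q) (range f) x ->
  exists w, combination f w = x.
Proof.
move=> [n [c [a [H ->]]]].
have /choice[p Hp] : forall i, exists p : nat * nat, q p.1 = c i /\ f p.2 = a i.
  by move=> i; have [[k _ <-] [l _ <-]] := H i; exists (k, l).
exists [seq p i | i <- enum 'I_n].
rewrite /combination big_map big_enum /=; apply: eq_bigr => i _.
by have [-> ->] := Hp i.
Qed.

End Combinations.

Lemma countable_range_nat (T : countType) (t0 : T) (V : Type) (f : T -> V) :
  exists q : nat -> V, range f = range q.
Proof.
exists (fun n => f (odflt t0 (unpickle n))); apply/seteqP; split=> [_ [t _ <-]|_ [n _ <-]].
  by exists (pickle t) => //; rewrite pickleK.
by exists (odflt t0 (unpickle n)).
Qed.

(** * Approximate descending sequences *)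

Section ApproximationTree.
Variables (R : realType) (E : metricType R) (D : nat -> E).
Hypothesis D_dense : forall x eps, 0 < eps -> exists n, mdist (D n) x <= eps.
Variables (S : Type) (prec : S -> S -> Prop).
Variables (F G : S -> nat -> nat) (s : S -> seq nat) (phi : S -> nat -> E).
(* [valid k j]: the value [phi a j] is determined by [a] at height [k]. *)
Variable valid : nat -> nat -> bool.
Hypothesis valid_leq : forall k l j, (k <= l)%N -> valid k j -> valid l j.
Hypothesis valid_ex : forall j, exists k, valid k j.
Hypothesis s_sorted : forall a, sorted ltn (s a).
Hypothesis precP : forall a b, prec a b ->
  [/\ F a = F b, G a = G b, exists m, s a = rcons (s b) m &
    forall j, valid (size (s b)) j -> phi a j = phi b j].

Let height a := size (s a).

Let approx_ex a j : exists n, mdist (D n) (phi a j) <= 2^-1 ^+ height a.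
Proof. by apply: D_dense; rewrite exprn_gt0// invr_gt0. Qed.

Let approx a j := sval (cid (approx_ex a j)).

Let approxP a j : mdist (D (approx a j)) (phi a j) <= 2^-1 ^+ height a.
Proof. exact: svalP (cid (approx_ex a j)). Qed.

Record node := Node { nF : seq nat; nG : seq nat; nS : seq nat; nD : seq nat }.

Definition node_code t := (nF t, nG t, nS t, nD t).
Definition node_decode p := let: (a, b, c, d) := p in Node a b c d.
Lemma node_codeK : cancel node_code node_decode. Proof. by case. Qed.
HB.instance Definition _ := Countable.copy node (can_type node_codeK).

Let truncation a := let k := height a in
  Node (mkseq (F a) k) (mkseq (G a) k) (s a) (mkseq (fun j => approx a j) k).

(* The approximations of a common limit at heights [k] and [k + 1] are within
   [2^-k + 2^-(k+1)] of each other. Both nodes must truncate actual elements,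
   but these need not be related by [prec]. *)
Let node_lt t t' : Prop :=
  [/\ exists a, truncation a = t, exists a, truncation a = t',
    size (nS t) = (size (nS t')).+1 &
    forall i, (i < size (nS t'))%N ->
      [/\ nth 0%N (nF t) i = nth 0%N (nF t') i,
        nth 0%N (nG t) i = nth 0%N (nG t') i,
        nth 0%N (nS t) i = nth 0%N (nS t') i &
        valid (size (nS t')) i ->
        mdist (D (nth 0%N (nD t) i)) (D (nth 0%N (nD t') i)) <=
          2 * 2^-1 ^+ size (nS t')]].

Let truncation_lt a b : prec a b -> node_lt (truncation a) (truncation b).
Proof.
move=> /precP[FE GE [m sE] phiE].
have hE : height a = (height b).+1 by rewrite /height sE size_rcons.
split; [by exists a|by exists b|exact: hE|move=> i ib].
have ia : (i < height a)%N by rewrite hE ltnS ltnW.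
rewrite /= !nth_mkseq// FE GE sE nth_rcons ib; split=> // /phiE vi.
apply: le_trans (metric_triangle _ (phi a i) _) _.
rewrite mulr_natl mulr2n lerD//; last first.
  by rewrite vi metric_sym; exact: approxP b i.
apply: le_trans (approxP a i) _; rewrite hE exprS.
have : (0 : R) <= 2^-1 ^+ height b by rewrite exprn_ge0.
lra.
Qed.

Hypothesis E_complete : complete_metric E.
Hypothesis prec_rank : ~ countable_rank prec.

(** Elements of [S] along a branch of nodes need not be related, so they have no common map. Still,
    one taken late enough agrees with the limit data and nearly attains two limit values at once, as
    distance estimates require. *)
Lemma approximation_limit : exists (F' G' s' : nat -> nat) (psi : nat -> E),
  {homo s' : i j / (i < j)%N} /\
  forall m j j' eps, 0 < eps -> exists a,
    [/\ F a m = F' m /\ G a m = G' m,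
      valid (height a) j /\ valid (height a) j',
      forall i, (i < height a)%N -> nth 0%N (s a) i = s' i,
      mdist (psi j) (phi a j) <= eps &
      mdist (psi j') (phi a j') <= eps].
Proof.
have : ~ wellfounded node_lt.
  move=> W; apply: prec_rank.
  exact: (@countable_rank_map _ node_lt W _ prec truncation truncation_lt).
rewrite /wellfounded => /contrapT[t tlt].
have /choice[a aE] : forall n, exists a, truncation a = t n.
  by move=> n; have [_] := tlt n.
pose k n := height (a n).
have kE n : size (nS (t n)) = k n by rewrite -aE.
have kS n : k n.+1 = (k n).+1 by rewrite -!kE; have [] := tlt n.
have k_ge n : (n <= k n)%N.
  by elim: n => // n IH; rewrite kS ltnS.
have k_mono n m : (n <= m)%N -> (k n <= k m)%N.
  by move=> nm; rewrite -(subnKC nm); elim: (m - n)%N => [|d IH];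
    rewrite ?addn0// addnS kS leqW.
have step n i : (i < k n)%N -> [/\ F (a n.+1) i = F (a n) i, G (a n.+1) i = G (a n) i,
    nth 0%N (s (a n.+1)) i = nth 0%N (s (a n)) i & valid (k n) i ->
    mdist (D (approx (a n.+1) i)) (D (approx (a n) i)) <= 2 * 2^-1 ^+ k n].
  move=> i_n; have [_ _ _ /(_ i)] := tlt n; rewrite kE => /(_ i_n).
  have i_n1 : (i < height (a n.+1))%N by rewrite -/(k _) kS ltnS ltnW.
  by rewrite -!aE /= !nth_mkseq.
have stable n m i : (i < k n)%N -> (n <= m)%N ->
    [/\ F (a m) i = F (a n) i, G (a m) i = G (a n) i &
     nth 0%N (s (a m)) i = nth 0%N (s (a n)) i].
  move=> i_n nm; rewrite -(subnKC nm); elim: (m - n)%N => [|d IH].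
    by rewrite addn0.
  rewrite addnS; have [|-> -> -> _] := step (n + d)%N i; last by [].
  by rewrite (leq_trans i_n)// k_mono// leq_addr.
have psi_ex j : exists l, forall eps, 0 < eps ->
    exists n, forall m, (n <= m)%N -> mdist l (D (approx (a m) j)) <= eps.
  have [n0 vn0] := valid_ex j.
  (* From this stage on [j] is valid and its approximation is stored in the node. *)
  apply: (@complete_geometric_sequence _ _ _ (maxn n0 j.+1)) => // n.
  rewrite geq_max => /andP[n0n jn].
  have jk : (j < k n)%N by apply: leq_trans (k_ge n).
  have [_ _ _ /(_ (valid_leq _ vn0))] := step n j jk.
  rewrite metric_sym => /(_ (leq_trans n0n (k_ge n)))/le_trans; apply.
  by rewrite ler_wpM2l// ler_wiXn2l//; lra.
have [psi psiH] := choice psi_ex.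
(* Stage [i.+1] has height above [i], so entry [i] is already final there. *)
exists (fun i => F (a i.+1) i), (fun i => G (a i.+1) i),
  (fun i => nth 0%N (s (a i.+1)) i), psi; split.
  move=> i j ij.
  have [| |_ _ <-] := @stable i.+1 j.+1 i; [exact: (k_ge i.+1)|exact: leqW|].
  apply: (sorted_ltn_nth ltn_trans 0%N (s_sorted _)) => //; rewrite inE.
    by apply: leq_trans (k_ge j.+1); rewrite leqW.
  exact: (k_ge j.+1).
move=> m j j' eps eps0.
have e20 : 0 < eps / 2 by rewrite divr_gt0.
have [n1 Hn1] := psiH j _ e20; have [n2 Hn2] := psiH j' _ e20.
have [v1 Hv1] := valid_ex j; have [v2 Hv2] := valid_ex j'.
have [n3 Hn3] := half_pow_small 1 e20.
pose n := (n1 + n2 + n3 + v1 + v2 + m.+1)%N.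
have close l nl : (forall m, (nl <= m)%N ->
    mdist (psi l) (D (approx (a m) l)) <= eps / 2) -> (nl <= n)%N ->
    mdist (psi l) (phi (a n) l) <= eps.
  move=> /(_ n) H /H {}H.
  apply: le_trans (metric_triangle _ (D (approx (a n) l)) _) _.
  have : 2^-1 ^+ k n <= eps / 2.
    rewrite -[leLHS]mul1r; apply: Hn3; apply: leq_trans (k_ge n).
    by rewrite /n; lia.
  by have := approxP (a n) l; rewrite -/(k n); lra.
exists (a n); split.
- have [||-> -> _] := @stable m.+1 n m; [exact: k_ge|rewrite /n; lia|by []].
- by split; [apply: valid_leq Hv1|apply: valid_leq Hv2];
    apply: leq_trans (k_ge n); rewrite /n; lia.
- move=> i ik; have [ni|ni] := leqP n i.+1.
    by have [||_ _ ->] := @stable n i.+1 i.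
  by have [||_ _ ->] := @stable i.+1 n i; [exact: k_ge|exact: ltnW|].
- by apply: close Hn1 _; rewrite /n; lia.
- by apply: close Hn2 _; rewrite /n; lia.
Qed.

End ApproximationTree.

(** If [e i = e j] with [i < j], then [e i - e j] has a nonzero partial sum after [i] and a zero one
    after [j], against the basis constant. *)
Lemma schauder_basis_inj (R : realType) (X : completeNormedModType R)
    (e : nat -> X) : schauder_basis e -> injective e.
Proof.
move=> basis; have [B eB] := schauder_basis_constant basis.
suff lt_neq i j : (i < j)%N -> e i <> e j.
  by move=> i j; case: (ltngtP i j) => // [/lt_neq H /H//|/lt_neq H /esym /H].
move=> ij eij; pose a k : R := (k == i)%:R - (k == j)%:R.
have deltaE k N : expansion (fun l => (l == k)%:R) e N = if (k < N)%N then e k else 0.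
  elim: N => [|N IH]; first by rewrite expansionE big_geq.
  rewrite expansionS IH ltnS; case: ltngtP => [kN|kN|->].
  - by rewrite scale0r addr0.
  - by rewrite scale0r addr0.
  - by rewrite scale1r add0r.
have := eB a _ _ (leqW ij : (i.+1 <= j.+1)%N).
rewrite !expansionB !deltaE !ltnSn ltnS leqNgt ij /= ltnS (ltnW ij) eij.
rewrite subrr normr0 mulr0 subr0 normr_le0.
by rewrite (negPf (schauder_basis_neq0 basis j)).
Qed.

(** * Quadruples of [coa] and their limit *)

Section Attempts.
Variables (R : realType) (X : completeNormedModType R) (e : nat -> X).
Variables (E : metricType R) (q : nat -> R).
Hypothesis e_inj : injective e.

Local Notation C := (range q).
Local Notation span := (rspan C (range e)).
Local Notation attempt := (coa C e E).

Let span_combination (f : nat -> nat) w :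
  rspan C (range e) (combination q (e \o f) w).
Proof. by apply: combination_rspan => p _; exists (f p.2). Qed.

Definition span_point (f : nat -> nat) w : span :=
  exist _ (combination q (e \o f) w) (mem_set (span_combination f w)).

Definition code (j : nat) : seq (nat * nat) := odflt [::] (unpickle j).

Let support_ex (c : attempt) : exists s : seq nat,
  sorted ltn s /\ coa_set c = [set e i | i in [set` s]].
Proof.
have /finite_seqP[l lE] := coa_fin c.
pose idx x := xget 0%N [set i | e i = x].
have idxE x : x \in l -> e (idx x) = x.
  move=> xl; have [|i _ ix] := @coa_sub _ _ _ _ _ c x; first by rewrite lE.
  by rewrite /idx; case: xgetP => [k _ //|/(_ i)].
exists (sort leq (undup [seq idx x | x <- l])); split.
  by rewrite ltn_sorted_uniq_leq sort_uniq undup_uniq (sort_sorted leq_total).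
rewrite lE; apply/seteqP; split=> x /=.
  move=> xl; exists (idx x); last exact: idxE.
  by rewrite /= mem_sort mem_undup map_f.
move=> [i /=]; rewrite mem_sort mem_undup => /mapP[y yl ->] <-.
by rewrite idxE.
Qed.

Let support c := sval (cid (support_ex c)).

Let support_sorted c : sorted ltn (support c).
Proof. by have [] := svalP (cid (support_ex c)). Qed.

Let coa_setE c : coa_set c = [set e i | i in [set` support c]].
Proof. by have [] := svalP (cid (support_ex c)). Qed.

Let support_unique c t : sorted ltn t -> coa_set c = [set e i | i in [set` t]] ->
  support c = t.
Proof.
move=> t_sorted; rewrite coa_setE => st.
apply: (irr_sorted_eq ltn_trans ltnn) => // i.
have /seteqP[H1 H2] := st; apply/idP/idP => ii.
  by have [|k kt /e_inj <-] := H1 (e i); first by exists i.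
by have [|k kt /e_inj <-] := H2 (e i); first by exists i.
Qed.

Let point_rspan c w : indices_below (size (support c)) w ->
  rspan C (coa_set c) (val (span_point (nth 0%N (support c)) w)).
Proof.
move=> /allP wc; apply: combination_rspan => p /wc pc.
by rewrite coa_setE; exists (nth 0%N (support c) p.2) => //=; rewrite mem_nth.
Qed.

(** Codes refer to positions in the support of [c], not to basis indices. Positions past its end
    default to [e 0] and are excluded by [indices_below]. *)
Let values c j := coa_map c (span_point (nth 0%N (support c)) (code j)).

(* The witnesses are chosen as functions of the moduli alone, so attempts
   related by [coa_lt] share them. *)
Let upper_ex (w : Zset R -> \bar R) : exists F : nat -> nat,
  (forall r, (w r < +oo)%E) -> modulus w ->
  forall m, (w (Znat R m) <= (F m)%:R%:E)%E.
Proof.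
have [wfin|] := pselect (forall r, (w r < +oo)%E); last by exists (fun=> 0%N).
have [wmod|] := pselect (modulus w); last by exists (fun=> 0%N).
by have [F FH] := M_coarse_upper wfin wmod; exists F.
Qed.

Let lower_ex (k : Zset R -> \bar R) : exists G : nat -> nat,
  (fun n => k (Znat R n)) @ \oo --> +oo%E ->
  forall m, (m%:R%:E <= k (Znat R (G m)))%E.
Proof.
have [kG|] := pselect ((fun n => k (Znat R n)) @ \oo --> +oo%E); last first.
  by exists (fun=> 0%N).
by have [G GH] := M_coarse_lower kG; exists G.
Qed.

Let upper (c : attempt) := sval (cid (upper_ex (coa_w c))).
Let lower (c : attempt) := sval (cid (lower_ex (coa_k c))).

Let coa_upper (c : attempt) (x y : span) m : rspan C (coa_set c) (val x) ->
  rspan C (coa_set c) (val y) -> norm_dist x y <= m.+1%:R ->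
  mdist (coa_map c x) (coa_map c y) <= (upper c m)%:R.
Proof.
move=> xc yc xym; have [<-|xy] := pselect (x = y); first by rewrite mdistxx.
have [_ [wmod [wfin _]]] := coa_mod c.
have [_ cxy] := coa_bounds xc yc xy; rewrite -lee_fin.
apply: le_trans cxy _.
apply: le_trans (svalP (cid (upper_ex (coa_w c))) wfin wmod m).
have d0 : 0 < norm_dist x y.
  by rewrite normr_gt0 subr_eq0; apply/eqP => /val_inj.
(* [Znat R m] has value [m.+1], so the least element of [Zset] above the distance does not exceed
   it. *)
by apply: wmod.2; have [_ H] := ZplusP d0; exact: (H (Znat R m)).
Qed.

Let coa_lower (c : attempt) (x y : span) m : rspan C (coa_set c) (val x) ->
  rspan C (coa_set c) (val y) -> (lower c m).+1%:R <= norm_dist x y ->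
  m%:R <= mdist (coa_map c x) (coa_map c y).
Proof.
move=> xc yc xym.
have d0 : 0 < norm_dist x y by apply: lt_le_trans xym; rewrite ltr0n.
have xy : x <> y by move=> xy; rewrite xy /norm_dist subrr normr0 ltxx in d0.
have [kmod [_ [_ kG]]] := coa_mod c.
have [cxy _] := coa_bounds xc yc xy; rewrite -lee_fin.
apply: le_trans cxy; apply: le_trans (svalP (cid (lower_ex (coa_k c))) kG m) _.
by apply: kmod.2; have [_ H] := ZminusP d0; exact: (H (Znat R (lower c m))).
Qed.

(** Injectivity of [e] makes the sorted support canonical, so a one-step extension appends its last
    index and leaves earlier positions, hence the points coded there, unchanged. *)
Let extensionP (a b : attempt) : coa_lt a b ->
  [/\ upper a = upper b, lower a = lower b, exists m, support a = rcons (support b) m &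
    forall j, indices_below (size (support b)) (code j) -> values a j = values b j].
Proof.
move=> [kE [wE [[s0 [m [s0_sorted [bE aE]]]] map_eq]]].
have sa := support_unique s0_sorted aE.
have sb : support b = s0.
  apply: support_unique bE; move: s0_sorted.
  by rewrite -cats1 => /cat_sorted2[].
split; [by rewrite /upper wE|by rewrite /lower kE|by exists m; rewrite sa sb|].
move=> j jb; rewrite /values -map_eq; last exact: point_rspan.
congr (coa_map a _); apply: val_inj; apply: eq_combination jb _ => i ib /=.
by rewrite sa -sb nth_rcons ib.
Qed.

Hypotheses (E_complete : complete_metric E) (E_separable : separable_metric E).

Lemma uncountable_rank_limit : ~ countable_rank (@coa_lt R X C e E) ->
  exists (F G s : nat -> nat) (psi : nat -> E),
    {homo s : i j / (i < j)%N} /\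
    forall m j j',
      let d := `|combination q (e \o s) (code j) - combination q (e \o s) (code j')| in
      (d <= m.+1%:R -> mdist (psi j) (psi j') <= (F m)%:R) /\
      ((G m).+1%:R <= d -> m%:R <= mdist (psi j) (psi j')).
Proof.
move=> rank.
(* The span contains 0, so if [E] is empty there are no quadruples and the rank is zero. *)
have [x0] : inhabited E.
  apply: contrapT => E0; apply: rank.
  have no (c : attempt) : False by apply: E0; constructor; exact: (@coa_map _ _ _ _ _ c (span_point id [::])).
  exists (fun '(ex_intro a _) => no (a 0%N)).
  by exists (fun=> osup (False_rect Ord)) => b [a _]; case: (no a).
have [D D_dense] := separable_dense_sequence x0 E_separable.
have [F [G [s [psi [s_mono H]]]]] := @approximation_limit R E D D_dense
  attempt (@coa_lt R X C e E) upper lower support values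
  (fun k j => indices_below k (code j))
  (fun k l j => @indices_below_leq k l (code j))
  (fun j => indices_below_ex (code j)) support_sorted extensionP E_complete rank.
exists F, G, s, psi; split=> // m j j' d.
(* The support of [c] agrees with [s] on the positions used, so both codes give the same vectors
   along either. *)
have dE c : indices_below (size (support c)) (code j) ->
    indices_below (size (support c)) (code j') ->
    (forall i, (i < size (support c))%N -> nth 0%N (support c) i = s i) ->
    d = norm_dist (span_point (nth 0%N (support c)) (code j))
          (span_point (nth 0%N (support c)) (code j')).
  move=> vj vj' sE; rewrite /d /norm_dist /=.
  by congr `|_ - _|; [apply: eq_combination vj _|apply: eq_combination vj' _] =>
    i ic /=; rewrite sE.
split=> [dm|dm]; apply/ler_addgt0Pr => eps eps0.
  have [c [[FE _] [vj vj'] sE Hj Hj']] := H m j j' (eps / 2) (divr_gt0 eps0 (ltr0n _ 2)).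
  have := coa_upper (point_rspan vj) (point_rspan vj').
  rewrite -(dE c)// => /(_ m dm); rewrite FE -/(values c j) -/(values c j').
  have := metric_triangle (psi j) (values c j) (psi j').
  have := metric_triangle (values c j) (values c j') (psi j').
  by rewrite (metric_sym (values c j') (psi j')); lra.
have [c [[_ GE] [vj vj'] sE Hj Hj']] := H m j j' (eps / 2) (divr_gt0 eps0 (ltr0n _ 2)).
have := coa_lower (point_rspan vj) (point_rspan vj').
rewrite -(dE c)// => /(_ m); rewrite GE => /(_ dm); rewrite -/(values c j) -/(values c j').
have := metric_triangle (values c j) (psi j) (values c j').
have := metric_triangle (psi j) (psi j') (values c j').
by rewrite (metric_sym (values c j) (psi j)); lra.
Qed.

(** Each point is sent to the value of [psi] at any one of its codes. Reading the codes along
    [e \o s] instead of [e] changes distances by a factor of at most [K], which the bounds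
    absorb. *)
Lemma coarse_embedding_of_subsequence (F G s : nat -> nat) (psi : nat -> E) :
  subsymmetric e -> {homo s : i j / (i < j)%N} ->
  (forall m j j',
    let d := `|combination q (e \o s) (code j) - combination q (e \o s) (code j')| in
    (d <= m.+1%:R -> mdist (psi j) (psi j') <= (F m)%:R) /\
    ((G m).+1%:R <= d -> m%:R <= mdist (psi j) (psi j'))) ->
  exists phi : span -> E, coarse_embedding (@norm_dist R X span) phi.
Proof.
move=> ess s_mono H; have [K [K0 esK eK]] := subsymmetric_subsequence ess s_mono.
have /choice[j jE] : forall x : span, exists j, combination q e (code j) = val x.
  move=> x; have [w wE] := rspan_combination (set_mem (svalP x)).
  by exists (pickle w); rewrite /code pickleK.
have dist_le x y :
    `|combination q (e \o s) (code (j x)) - combination q (e \o s) (code (j y))|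
      <= K * norm_dist x y /\ norm_dist x y <=
    K * `|combination q (e \o s) (code (j x)) - combination q (e \o s) (code (j y))|.
  have [a [N aE]] := combinationB_expansion X q (code (j x)) (code (j y)).
  by rewrite /norm_dist -!jE !aE.
exists (psi \o j); apply: coarse_embedding_bounds; first exact: (span_point id [::]).
  move=> m; exists (F (Num.truncn (K * m.+1%:R)))%:R => x y xym.
  apply: (H _ _ _).1; apply: le_trans (ltW (truncnS_gt _)).
  by apply: le_trans (dist_le x y).1 _; rewrite ler_pM2l.
move=> m; exists (K * (G m).+1%:R) => x y xym.
apply: (H _ _ _).2; rewrite -(ler_pM2l K0).
exact: le_trans (dist_le x y).2.
Qed.

End Attempts.

Theorem theorem2p5 (R : realType) (X : completeNormedModType R)
    (e : nat -> X) (E : metricType R) (C : set R) :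
  subsymmetric e ->
  complete_metric E -> separable_metric E ->
  (C = range (fun z : int => z%:~R) \/ C = range (fun q : rat => ratr q)) ->
  (exists phi : rspan C (range e) -> E,
     coarse_embedding (@norm_dist R X (rspan C (range e))) phi) \/
  countable_rank (@coa_lt R X C e E).
Proof.
move=> ess E_complete E_separable CE.
have [q ->] : exists q : nat -> R, C = range q.
  by case: CE => ->; [exact: (countable_range_nat (0 : int))
                     |exact: (countable_range_nat (0 : rat))].
have e_inj := schauder_basis_inj ess.1.1.
have [|rank] := pselect (countable_rank (@coa_lt R X (range q) e E)); first by right.
left; have [F [G [s [psi [s_mono H]]]]] :=
  uncountable_rank_limit e_inj E_complete E_separable rank.
exact: coarse_embedding_of_subsequence ess s_mono H.
Qed.
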